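(* Let $\mathcal{S}_0:=\mathcal{V}\cap\mathcal{X}^{[\mathcal{L}]}$ and $\mathcal{S}_{i+1}:=\mathcal{C}(\mathcal{S}_i)\cap\mathcal{S}_0$ for $i\ge 0$. Then there exists a finite integer $\overline{k}\geq 1$ such that $$\mathcal{S}_{\overline{k}}=\mathcal{S}_{\overline{k}+1},$$ and the maximal admissible invariant set $\mathcal{M}$ with respect to the system $x(t+1)=A_{\sigma(t)}x(t)$ and the constraints $x(t)\in\mathcal{X}$ is $\mathcal{M}=\operatorname{lower}(\mathcal{S}_{\overline{k}})$.
   Context: System. Let $\mathcal{A}=\{A_1,\dots,A_M\}\subset\mathbb{R}^{n\times n}$. The switching system is $x(t+1)=A_{\sigma(t)}x(t)$, $t\in\mathbb{N}=\{0,1,2,\dots\}$, where $x(0)\in\mathbb{R}^n$ and $\sigma:\mathbb{N}\to\{1,\dots,M\}$ is an arbitrary switching signal. Constraint set. $\mathcal{X}=\{x\in\mathbb{R}^n: c_i(x)\le 1,\ i=1,\dots,p\}$, where $c_1,\dots,c_p$ are real polynomials of maximum degree $d\ge 1$, with no constant term (all monomials have degree in $\{1,\dots,d\}$). The state constraints are $x(t)\in\mathcal{X}$ for all $t\ge 0$. Standing assumptions. (1) The system is asymptotically stable (under arbitrary switching); equivalently, the joint spectral radius $\rho(\mathcal{A})=\lim_{t\to\infty}\max\{\|A\|^{1/t}: A \text{ a product of } t \text{ elements of } \mathcal{A}\}$ satisfies $\rho(\mathcal{A})<1$. (2) $\mathcal{X}$ is closed, bounded and contains the origin in its interior. Invariance.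 A set $\mathcal{S}\subset\mathbb{R}^n$ is invariant with respect to the system if $x(0)\in\mathcal{S}$ implies $x(t)\in\mathcal{S}$ for all $t\in\mathbb{N}$ and all switching signals; it is admissible invariant if moreover $\mathcal{S}\subseteq\mathcal{X}$. The maximal admissible invariant set $\mathcal{M}$ is the admissible invariant set that contains every admissible invariant set. Lifting. For an integer $l\ge 1$, the $l$-lift $x^{[l]}\in\mathbb{R}^{\binom{n+l-1}{l}}$ of $x\in\mathbb{R}^n$ is the vector with entries $\sqrt{\alpha!}\,x^\alpha$, over all $\alpha\in\mathbb{N}^n$ with $\sum_i\alpha_i=l$ (in a fixed order), where $x^\alpha=x_1^{\alpha_1}\cdots x_n^{\alpha_n}$ and $\alpha!:=\frac{l!}{\alpha_1!\cdots\alpha_n!}$ denotes the multinomial coefficient. For $A\in\mathbb{R}^{n\times n}$, $A^{[l]}$ is the matrix of the linear map satisfying $A^{[l]}x^{[l]}=(Ax)^{[l]}$ for all $x\in\mathbb{R}^n$. Let $\mathcal{L}=\{l_1,\dots,l_K\}\subseteq\{1,\dots,d\}$ (ordered) be the set of degrees of all monomials appearing in $c_1,\dots,c_p$, and $N=\sum_{l\in\mathcal{L}}\binom{n+l-1}{l}$. Then $x^{[\mathcal{L}]}\in\mathbb{R}^N$ is obtained by stacking $x^{[l_1]},\dots,x^{[l_K]}$, and $A_i^{[\mathcal{L}]}:=\operatorname{diag}(A_i^{[l_1]},\dots,A_i^{[l_K]})$ (block diagonal). Let $g_i\in\mathbb{R}^N$ be the vector with $c_i(x)=g_i^\top x^{[\mathcal{L}]}$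 for all $x$. Define $\mathcal{X}^{[\mathcal{L}]}:=\{y\in\mathbb{R}^N: g_i^\top y\le 1,\ i=1,\dots,p\}$ and $\mathcal{V}:=\{x^{[\mathcal{L}]}: x\in\mathbb{R}^n\}\subset\mathbb{R}^N$. Maps. For $\mathcal{S}\subseteq\mathbb{R}^N$: $\operatorname{lower}(\mathcal{S}):=\{x\in\mathbb{R}^n: x^{[\mathcal{L}]}\in\mathcal{S}\}$, and the pre-image map is $\mathcal{C}(\mathcal{S}):=\{y\in\mathbb{R}^N: A_i^{[\mathcal{L}]}y\in\mathcal{S}\ \text{for all } i=1,\dots,M\}$. *)

(* Defs.v *)
(* MathComp / MathComp-Analysis, with multinomials for polynomials.
   R^n is the type of column vectors 'cV[R]_n. *)
From HB Require Import structures.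
From mathcomp Require Import all_boot all_order all_algebra.
(* The notations of mpoly clash with those of MathComp-Analysis. *)
From mathcomp.multinomials Require Import -(notations) mpoly.
From mathcomp Require Import all_classical all_reals all_analysis.

Set Implicit Arguments.
Unset Strict Implicit.
Unset Printing Implicit Defensive.

Import Order.TTheory GRing.Theory Num.Theory.
Import numFieldNormedType.Exports.

Local Open Scope classical_set_scope.
Local Open Scope ring_scope.

Section SwitchingSystem.
Context {R : realType} {n M : nat}.
Implicit Types (A : 'I_M -> 'M[R]_n) (S X : set 'cV[R]_n).

Fixpoint trajectory A (sigma : nat -> 'I_M) (x0 : 'cV[R]_n) (t : nat)
    : 'cV[R]_n :=
  if t is t'.+1 then A (sigma t') *m trajectory A sigma x0 t' else x0.

(* delta is uniform over the switching signals. *)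
Definition lyapunov_stable A : Prop :=
  forall eps : R, 0 < eps -> exists2 delta : R, 0 < delta &
    forall (sigma : nat -> 'I_M) (x0 : 'cV[R]_n), `|x0| < delta ->
      forall t, `|trajectory A sigma x0 t| < eps.

Definition attractive A : Prop :=
  forall (sigma : nat -> 'I_M) (x0 : 'cV[R]_n),
    trajectory A sigma x0 t @[t --> \oo] --> (0 : 'cV[R]_n).

Definition asymptotically_stable A : Prop :=
  lyapunov_stable A /\ attractive A.

Definition invariant_set A S : Prop :=
  forall x0, S x0 -> forall (sigma : nat -> 'I_M) t, S (trajectory A sigma x0 t).

Definition admissible_invariant A X S : Prop :=
  invariant_set A S /\ S `<=` X.

Definition maximal_admissible_invariant A X S : Prop :=
  admissible_invariant A X S /\
  forall S', admissible_invariant A X S' -> S' `<=` S.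

End SwitchingSystem.

Section Constraints.
Context {R : realType} {n p : nat}.
Implicit Types c : 'I_p -> mpoly n R.

Definition mpoly_at (q : mpoly n R) (x : 'cV[R]_n) : R :=
  meval (fun j => x j ord0) q.

Definition constraint_set c : set 'cV[R]_n :=
  [set x | forall i, mpoly_at (c i) x <= 1].

(* The set L, as an increasing list. *)
Definition degrees (d : nat) c : seq nat :=
  [seq l <- iota 1 d | [exists i, has (fun m => mdeg m == l) (msupp (c i))]].

End Constraints.

(* The exponents of total degree l, in the order of enum; expo k is the k-th. *)
Section Exponents.
Variables (n l : nat).

Definition exponents : {set bmultinom n l.+1} :=
  [set a : bmultinom n l.+1 | mdeg a == l]%SET.

Lemma card_exponents : #|exponents| = 'C(n + l - 1, l).
Proof.
rewrite cardE -(size_map (@bmnm n l.+1)).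
have /perm_size -> : perm_eq [seq bmnm a | a <- enum exponents]
    [seq s2m (val t) | t <- enum (mpoly.basis n l)].
  apply: uniq_perm.
  - by rewrite map_inj_uniq ?enum_uniq //; exact: val_inj.
  - exact: uniq_basis.
  move=> m; rewrite -basis_cover; apply/mapP/idP.
    by case=> a; rewrite mem_enum inE => ? ->.
  move=> mdm; have ltm : (mdeg m < l.+1)%N by rewrite (eqP mdm).
  by exists (BMultinom ltm); rewrite // mem_enum inE.
case: n => [|n']; last by rewrite size_basis addSn subn1 /= addnC.
rewrite size_map -cardE; case: l => [|l'].
  rewrite (_ : mpoly.basis 0 0 = [set: 0.-tuple 'I_0]%SET) ?cardsT ?card_tuple //.
  by apply/setP=> t; rewrite !inE tuple0.
rewrite add0n subn1 bin_small //; apply: eq_card0 => t.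
by case: (thead t).
Qed.

Definition expo (k : 'I_('C(n + l - 1, l))) : multinom n :=
  enum_val (cast_ord (esym card_exponents) k).

Lemma expo_inj : injective expo.
Proof. by move=> i j /val_inj/enum_val_inj/cast_ord_inj. Qed.

Lemma mdeg_expo k : mdeg (expo k) = l.
Proof.
by have := enum_valP (cast_ord (esym card_exponents) k); rewrite inE => /eqP.
Qed.

Lemma expo_onto (m : multinom n) : mdeg m = l -> exists k, expo k = m.
Proof.
move=> mdm; have ltm : (mdeg m < l.+1)%N by rewrite mdm.
have im : BMultinom ltm \in exponents by rewrite inE /= mdm.
exists (cast_ord card_exponents (enum_rank_in im (BMultinom ltm))).
by rewrite /expo cast_ordK enum_rankK_in.
Qed.

End Exponents.

Definition lift_dim n Ls (k : 'I_(size Ls)) : nat :=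
  'C(n + tnth (in_tuple Ls) k - 1, tnth (in_tuple Ls) k).
Arguments lift_dim n Ls k : clear implicits.

(* R^N, in blocks indexed by the positions in the list of degrees Ls. *)
Notation lifted_space R n Ls := 'cV[R]_(\sum_k lift_dim n Ls k).

Section Lift.
Context {R : realType} {n : nat}.
Implicit Types (x : 'cV[R]_n) (B : 'M[R]_n) (Ls : seq nat).

(* The multinomial coefficient, written a! in the literature on lifts. *)
Definition multicoef (a : multinom n) : R :=
  (mdeg a)`!%:R / \prod_(i < n) (a i)`!%:R.

Definition monomial_at (a : multinom n) x : R := \prod_(i < n) x i ord0 ^+ a i.

Definition lift_vec l x : 'cV[R]_('C(n + l - 1, l)) :=
  \col_k (Num.sqrt (multicoef (expo k)) * monomial_at (expo k) x).

(* The polynomial (B x)^a in the entries of x. *)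
Definition monomial_comp (a : multinom n) B : mpoly n R :=
  \prod_(i < n) (\sum_(j < n) B i j *: mpolyX R (mnm1 j)) ^+ a i.

(* Read off by expanding each entry sqrt(a!) (B x)^a of (B x)^[l] in the basis
   sqrt(b!) x^b. As the monomials are linearly independent functions, this is
   the only matrix satisfying lift_mxE below. *)
Definition lift_mx l B : 'M[R]_('C(n + l - 1, l)) :=
  \matrix_(j, k) (Num.sqrt (multicoef (expo j)) / Num.sqrt (multicoef (expo k))
                  * mcoeff (expo k) (monomial_comp (expo j) B)).

Definition lift_vecs Ls x : lifted_space R n Ls :=
  \mxcol_k lift_vec (tnth (in_tuple Ls) k) x.

Definition lift_mxs Ls B : 'M[R]_(\sum_k lift_dim n Ls k) :=
  \mxdiag_k lift_mx (tnth (in_tuple Ls) k) B.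

(* The vector g with q(x) = g^T x^[L]; see coef_vecE and coef_vec_degrees. *)
Definition coef_vec Ls (q : mpoly n R) : lifted_space R n Ls :=
  \mxcol_k \col_j
    (mcoeff (@expo n (tnth (in_tuple Ls) k) j) q
     / Num.sqrt (multicoef (@expo n (tnth (in_tuple Ls) k) j))).

Lemma multicoef_gt0 a : 0 < multicoef a.
Proof.
rewrite /multicoef divr_gt0 ?ltr0n ?fact_gt0 //.
by apply: prodr_gt0 => i _; rewrite ltr0n fact_gt0.
Qed.

Lemma sqrt_multicoef_neq0 a : Num.sqrt (multicoef a) != 0.
Proof. by rewrite gt_eqF // sqrtr_gt0 multicoef_gt0. Qed.

Lemma sum_expo l (q : mpoly n R) x :
  \sum_k mcoeff (@expo n l k) q * monomial_at (expo k) x =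
  \sum_(m <- msupp q | mdeg m == l) mcoeff m q * monomial_at m x.
Proof.
pose F m := mcoeff m q * monomial_at m x.
rewrite -(big_map (@expo n l) xpredT F) (bigID (mem (msupp q))) /=.
rewrite [X in _ + X]big1 ?addr0; last first.
  by move=> m /memN_msupp_eq0; rewrite /F => ->; rewrite mul0r.
rewrite -big_filter -[RHS]big_filter; apply: perm_big.
apply: uniq_perm; rewrite ?filter_uniq ?msupp_uniq //.
  by rewrite map_inj_uniq ?index_enum_uniq //; exact: expo_inj.
move=> m; rewrite !mem_filter [RHS]andbC; congr andb.
apply/mapP/eqP=> [[k _ ->]|/expo_onto[k <-]]; first exact: mdeg_expo.
by exists k; rewrite ?mem_index_enum.
Qed.

Lemma mpoly_atE (q : mpoly n R) x :
  mpoly_at q x = \sum_(m <- msupp q) mcoeff m q * monomial_at m x.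
Proof. exact: mevalE. Qed.

Lemma mdeg_monomial_comp a B m :
  m \in msupp (monomial_comp a B) -> mdeg m = mdeg a.
Proof.
have hX i : \sum_(j < n) B i j *: mpolyX R (mnm1 j) \is ishomog1 1 (@mdeg n).
  by apply: rpred_sum => j _; apply: dhomogZ; rewrite dhomogX /= mdeg1.
suff /dhomogP : monomial_comp a B \is ishomog1 (mdeg a) (@mdeg n) by apply.
rewrite mdegE /monomial_comp.
elim/big_ind2: _ => [|e1 q1 e2 q2 h1 h2|i _].
- exact: dhomog1.
- exact: dhomogM.
by rewrite -[X in ishomog1 X]mul1n; apply: dhomogMn.
Qed.

Lemma mpoly_at_comp a B x :
  mpoly_at (monomial_comp a B) x = monomial_at a (B *m x).
Proof.
rewrite /mpoly_at /monomial_comp rmorph_prod; apply: eq_bigr => i _ /=.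
rewrite rmorphXn /= mxE raddf_sum /=; congr (_ ^+ _); apply: eq_bigr => j _.
by rewrite mevalZ mevalXU.
Qed.

Lemma lift_mxE l B x : lift_mx l B *m lift_vec l x = lift_vec l (B *m x).
Proof.
apply/colP=> j; rewrite !mxE -mpoly_at_comp mpoly_atE.
under eq_bigr => k _ do
  rewrite !mxE mulrACA divfK ?sqrt_multicoef_neq0 //.
rewrite -big_distrr /= sum_expo big_seq_cond [in RHS]big_seq; congr (_ * _).
apply: eq_bigl => m; case: (boolP (m \in _)) => //= /mdeg_monomial_comp ->.
by rewrite mdeg_expo eqxx.
Qed.

Lemma lift_mxsE Ls B x :
  lift_mxs Ls B *m lift_vecs Ls x = lift_vecs Ls (B *m x).
Proof.
rewrite /lift_mxs /lift_vecs mul_mxdiag_mxcol; apply: eq_mxcol => k.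
exact: lift_mxE.
Qed.

Lemma coef_vecE Ls (q : mpoly n R) x : uniq Ls ->
  (forall m, m \in msupp q -> mdeg m \in Ls) ->
  ((coef_vec Ls q)^T *m lift_vecs Ls x) ord0 ord0 = mpoly_at q x.
Proof.
move=> uLs sLs; rewrite /coef_vec /lift_vecs tr_mxcol mul_mxrow_mxcol summxE.
rewrite mpoly_atE; transitivity (\sum_(k < size Ls)
  \sum_(m <- msupp q | mdeg m == tnth (in_tuple Ls) k)
    mcoeff m q * monomial_at m x).
  apply: eq_bigr => k _; rewrite !mxE -sum_expo.
  apply: eq_bigr => j _; rewrite !mxE mulrA divfK ?sqrt_multicoef_neq0 //.
rewrite (exchange_big_dep predT) //= [LHS]big_seq [RHS]big_seq.
apply: eq_bigr => m /sLs mLs.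
have ltm : (index (mdeg m) Ls < size Ls)%N by rewrite index_mem.
rewrite (big_pred1 (Ordinal ltm)) // => k /=.
rewrite (tnth_nth 0%N) -val_eqE /= -{1}(nth_index 0%N mLs) nth_uniq //
  1?eq_sym // index_mem.
Qed.

Lemma coef_vec_degrees p d (c : 'I_p -> mpoly n R) i x :
  (forall i m, m \in msupp (c i) -> (1 <= mdeg m <= d)%N) ->
  ((coef_vec (degrees d c) (c i))^T *m lift_vecs (degrees d c) x) ord0 ord0
  = mpoly_at (c i) x.
Proof.
move=> hc; apply: coef_vecE; first by rewrite filter_uniq ?iota_uniq.
move=> m mc; rewrite mem_filter mem_iota add1n ltnS (hc i m mc) andbT.
by apply/existsP; exists i; apply/hasP; exists m.
Qed.

End Lift.

Section LiftedSets.
Context {R : realType} {n : nat}.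
Variable Ls : seq nat.
Implicit Types S : set (lifted_space R n Ls).

Definition lifted_constraint_set p (c : 'I_p -> mpoly n R) :
    set (lifted_space R n Ls) :=
  [set y | forall i, ((coef_vec Ls (c i))^T *m y) ord0 ord0 <= 1].

Definition lifted_variety : set (lifted_space R n Ls) :=
  range (@lift_vecs R n Ls).

Definition lower S : set 'cV[R]_n := [set x | S (lift_vecs Ls x)].

Definition lifted_preimage M (A : 'I_M -> 'M[R]_n) S :
    set (lifted_space R n Ls) :=
  [set y | forall i, S (lift_mxs Ls (A i) *m y)].

Fixpoint set_sequence M (A : 'I_M -> 'M[R]_n) p (c : 'I_p -> mpoly n R)
    (k : nat) : set (lifted_space R n Ls) :=
  let S0 := lifted_variety `&` lifted_constraint_set c in
  if k is k'.+1 then lifted_preimage A (set_sequence A c k') `&` S0 else S0.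

End LiftedSets.

Arguments lifted_constraint_set {R n} Ls {p} c.
Arguments lifted_variety R n Ls : clear implicits.
Arguments lower {R n} Ls S.
Arguments lifted_preimage {R n} Ls {M} A S.
Arguments set_sequence {R n} Ls {M} A {p} c k.

(* Main.v *)
Require Import Defs.
From mathcomp Require Import all_boot all_order all_algebra.
From mathcomp.multinomials Require Import -(notations) mpoly.
From mathcomp Require Import all_classical all_reals all_analysis.
Import Order.TTheory GRing.Theory Num.Theory.
Import numFieldNormedType.Exports.
Local Open Scope classical_set_scope.
Local Open Scope ring_scope.

(** On the variety, the lifted recursion is the recursion of the original
    system: since [lift_mxs (A i)] maps the lift of [x] to the lift of
    [A i *m x], the lift of [x] lies in the [k]-th set exactly when every
    trajectory from [x] satisfies the constraints up to time [k]
    ([set_sequence_liftE]).  All the sets of the sequence are contained in the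
    variety, hence are determined by the points whose lifts they contain, and
    the sequence stops as soon as obeying the constraints up to some time [T]
    forces obeying them forever.

    Such a [T] comes from uniform attraction: there is [T] after which every
    trajectory starting in the bounded set [X] stays in a ball around 0
    contained in [X] ([uniform_attraction]).  Attractivity only says that each
    trajectory enters a given ball at a time that depends on the starting
    point and on the signal.  For a fixed starting point, the entrance time is
    bounded uniformly in the signal because the tree of switching choices is
    finitely branching ([uniform_hitting_time], a form of Koenig's lemma), and
    Lyapunov stability turns entering a small ball into remaining in a larger
    one ([signal_uniform_attraction]).  For a fixed signal, the trajectory is
    linear in the starting point, so that treating the vectors of the
    canonical basis is enough to handle a bounded set of starting points. *)

Section Trajectories.
Context {R : realType} {n M : nat}.
Implicit Types (A : 'I_M -> 'M[R]_n) (x : 'cV[R]_n) (sigma : nat -> 'I_M).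

Lemma trajectoryD A sigma x s t :
  trajectory A sigma x (s + t) =
  trajectory A (fun u => sigma (s + u)%N) (trajectory A sigma x s) t.
Proof. by elim: t => [|t IH]; rewrite ?addn0 // addnS /= IH. Qed.

Lemma trajectorySl A sigma x t :
  trajectory A sigma x t.+1 =
  trajectory A (fun u => sigma u.+1) (A (sigma 0%N) *m x) t.
Proof. exact: (trajectoryD A sigma x 1 t). Qed.

Lemma trajectory_sum A sigma (I : Type) (r : seq I) (a : I -> R)
    (v : I -> 'cV[R]_n) t :
  trajectory A sigma (\sum_(j <- r) a j *: v j) t =
  \sum_(j <- r) a j *: trajectory A sigma (v j) t.
Proof.
elim: t => //= t ->; rewrite mulmx_sumr.
by apply: eq_bigr => j _; rewrite -scalemxAr.
Qed.

(** The points from which every branch of the tree of switching choices meets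
    [D]; being inductive, it supports recursion on that tree. *)
Inductive inevitable A (D : set 'cV[R]_n) (x : 'cV[R]_n) : Prop :=
| inevitable_now of D x
| inevitable_later of (forall i, inevitable A D (A i *m x)).

(** A point where [D] is avoidable has a successor where it is avoidable;
    following such successors forever is a trajectory that misses [D]. *)
Lemma inevitable_of_signals A (D : set 'cV[R]_n) x :
  (forall sigma, exists t, D (trajectory A sigma x t)) -> inevitable A D x.
Proof.
move=> hitD; apply: contrapT => avoid.
have next y : ~ inevitable A D y -> exists i, ~ inevitable A D (A i *m y).
  move=> ay; apply: contrapT => none; apply: ay; apply: inevitable_later => i.
  by apply: contrapT => ai; apply: none; exists i.
(* The default choice i0 makes the selection function total. *)
have [i0 _] := next x avoid.
have /choice[g gP] : forall y, exists i,
    ~ inevitable A D y -> ~ inevitable A D (A i *m y).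
  move=> y; have [/next[i ai]|hy] := pselect (~ inevitable A D y).
    by exists i.
  by exists i0.
pose orb t := iter t (fun y => A (g y) *m y) x.
have avoid_orb t : ~ inevitable A D (orb t) by elim: t => // t /gP.
have [t] := hitD (fun t => g (orb t)).
suff -> : trajectory A (fun t => g (orb t)) x t = orb t.
  by move=> Dt; apply: (avoid_orb t); apply: inevitable_now.
by elim: t => //= t ->.
Qed.

Lemma inevitable_bounded A (D : set 'cV[R]_n) x : inevitable A D x ->
  exists T, forall sigma, exists2 t, (t <= T)%N & D (trajectory A sigma x t).
Proof.
elim=> {x} [x Dx|x _ /choice[T TP]]; first by exists 0%N => sigma; exists 0%N.
exists (\max_i T i).+1 => sigma.
have [t tT Dt] := TP (sigma 0%N) (fun u => sigma u.+1).
exists t.+1; last by rewrite trajectorySl.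
by rewrite ltnS (leq_trans tT) // leq_bigmax.
Qed.

Lemma uniform_hitting_time A (D : set 'cV[R]_n) x :
  (forall sigma, exists t, D (trajectory A sigma x t)) ->
  exists T, forall sigma, exists2 t, (t <= T)%N & D (trajectory A sigma x t).
Proof. by move/inevitable_of_signals/inevitable_bounded. Qed.

(** Entering the ball given by Lyapunov stability happens within a time
    independent of the signal, and confines the rest of the trajectory. *)
Lemma signal_uniform_attraction A x (eps : R) :
  asymptotically_stable A -> 0 < eps ->
  exists T, forall sigma t, (T <= t)%N -> `|trajectory A sigma x t| < eps.
Proof.
move=> [stab attr] /stab[delta delta0 deltaP].
have [T TP] : exists T, forall sigma,
    exists2 t, (t <= T)%N & `|trajectory A sigma x t| < delta.
  apply: (@uniform_hitting_time A [set y | `|y| < delta]) => sigma.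
  have /cvgr0_norm_lt/(_ _ delta0)[t _ tP] := attr sigma x.
  by exists t; apply: tP => /=.
exists T => sigma t Tt; have [s sT sP] := TP sigma.
by rewrite -(subnKC (leq_trans sT Tt)) trajectoryD; apply: deltaP.
Qed.

Lemma norm_entry_le x j : `|x j ord0| <= `|x|.
Proof.
rewrite [leRHS]mx_normrE.
exact: (le_bigmax _ (fun ij => `|x ij.1 ij.2|) (j, ord0)).
Qed.

(** For a fixed signal the trajectory is linear in the starting point, so the
    finitely many basis vectors control all the points of a bounded set. *)
Lemma uniform_attraction A (X : set 'cV[R]_n) (eps : R) :
  asymptotically_stable A -> bounded_set X -> 0 < eps ->
  exists T, forall x, X x -> forall sigma t, (T <= t)%N ->
    `|trajectory A sigma x t| < eps.
Proof.
move=> stab [B [_ BP]] eps0.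
(* eta leaves room for a sum of n terms with coefficients at most C. *)
pose C := `|B| + 1; pose eta := eps / (n%:R * C + 1).
have C0 : 0 <= C by rewrite addr_ge0.
have den0 : 0 < n%:R * C + 1 by rewrite ltr_wpDl // mulr_ge0.
have eta0 : 0 < eta by rewrite divr_gt0.
have /choice[T TP] : forall j : 'I_n, exists T, forall sigma t, (T <= t)%N ->
    `|trajectory A sigma (delta_mx j ord0) t| < eta.
  by move=> j; apply: signal_uniform_attraction.
exists (\max_j T j)%N => x Xx sigma t Tt.
rewrite [x]matrix_sum_delta; under eq_bigr do rewrite big_ord1.
rewrite trajectory_sum (le_lt_trans (ler_norm_sum _ _ _)) //.
apply: (@le_lt_trans _ _ (\sum_(j < n) C * eta)).
  apply: ler_sum => j _; rewrite normrZ ler_pM //.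
    apply: le_trans (norm_entry_le x j) _.
    by apply: BP; rewrite // ltr_pwDr // ler_norm.
  by apply/ltW/TP; apply: leq_trans Tt; apply: leq_bigmax.
rewrite sumr_const card_ord -mulr_natl mulrA /eta mulrCA gtr_pMr //.
by rewrite ltr_pdivrMr // mul1r ltrDl.
Qed.

End Trajectories.

Section LiftedRecursion.
Context {R : realType} {n M p : nat}.
Variables (d : nat) (A : 'I_M -> 'M[R]_n) (c : 'I_p -> mpoly n R).
Hypothesis hc : forall i m, m \in msupp (c i) -> (1 <= mdeg m <= d)%N.

Let L := degrees d c.
Let X := constraint_set c.

Lemma lifted_constraint_setE x :
  lifted_constraint_set L c (lift_vecs L x) <-> X x.
Proof. by split=> Xx i; have := Xx i; rewrite coef_vec_degrees. Qed.

Lemma set_sequence_lift0 x : set_sequence L A c 0 (lift_vecs L x) <-> X x.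
Proof.
rewrite -lifted_constraint_setE /=; split=> [[]//|Xx].
by split => //; exists x.
Qed.

Lemma set_sequence_liftS k x :
  set_sequence L A c k.+1 (lift_vecs L x) <->
  (forall i, set_sequence L A c k (lift_vecs L (A i *m x))) /\ X x.
Proof.
rewrite -set_sequence_lift0 /=; split=> -[Ck S0]; split=> // i; have := Ck i;
  by rewrite lift_mxsE.
Qed.

(** [X x] is a separate conjunct because an empty family of matrices has no
    switching signal, hence no trajectory that would record the starting point. *)
Lemma set_sequence_liftE k x :
  set_sequence L A c k (lift_vecs L x) <->
  X x /\ forall sigma t, (t <= k)%N -> X (trajectory A sigma x t).
Proof.
elim: k x => [|k IH] x.
  rewrite set_sequence_lift0; split=> [Xx|[]//].
  by split=> // sigma t; rewrite leqn0 => /eqP ->.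
rewrite set_sequence_liftS; split=> [[Sk Xx]|[Xx Xt]]; split=> //.
  move=> sigma [//|t] tk; rewrite trajectorySl.
  by have /IH[_] := Sk (sigma 0%N); apply.
move=> i; apply/IH; split; first exact: (Xt (fun=> i) 1%N).
move=> sigma t tk.
by have := Xt (fun u => if u is u'.+1 then sigma u' else i) t.+1 tk;
  rewrite trajectorySl.
Qed.

Lemma set_sequence_sub_variety k : set_sequence L A c k `<=` lifted_variety R n L.
Proof. by case: k => [|k] y; [case | case=> _ []]. Qed.

(** The sets lie in the variety, so it suffices to compare them on lifts. *)
Lemma set_sequence_eq k m :
  (forall x, set_sequence L A c k (lift_vecs L x) <->
             set_sequence L A c m (lift_vecs L x)) ->
  set_sequence L A c k = set_sequence L A c m.
Proof.
move=> eqS; apply/seteqP; split=> y Sy;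
  have [x _ xy] := set_sequence_sub_variety _ _ Sy;
  by move: Sy; rewrite -xy => /eqS.
Qed.

(** A fixed point of the recursion is invariant under each [A i], and every
    invariant subset of [X] obeys the constraints at all times. *)
Lemma maximal_of_stationary k :
  set_sequence L A c k = set_sequence L A c k.+1 ->
  maximal_admissible_invariant A X (lower L (set_sequence L A c k)).
Proof.
move=> stat; split; first split.
- move=> x Sx sigma; elim=> //= t; rewrite {1}stat => /set_sequence_liftS[St _].
  exact: St.
- by move=> x /set_sequence_liftE[].
move=> S [invS SX] x Sx; apply/set_sequence_liftE; split; first exact: SX.
by move=> sigma t _; apply/SX/invS.
Qed.

(** Once trajectories are trapped in [X] after time [T], obeying the
    constraints up to time [T] means obeying them forever. *)
Lemma set_sequence_stationary T :
  (forall x, X x -> forall sigma t, (T <= t)%N -> X (trajectory A sigma x t)) ->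
  set_sequence L A c T = set_sequence L A c T.+1.
Proof.
move=> trapped; apply: set_sequence_eq => x; rewrite !set_sequence_liftE.
split=> -[Xx Xt]; split=> // sigma t tT.
  by have [/Xt//|/ltnW] := leqP t T; apply: trapped.
by apply: Xt; apply: leqW.
Qed.

End LiftedRecursion.

Theorem theorem1 (R : realType) (n M p d : nat)
    (A : 'I_M -> 'M[R]_n) (c : 'I_p -> mpoly n R)
    (hd : (1 <= d)%N)
    (hc : forall i m, m \in msupp (c i) -> (1 <= mdeg m <= d)%N)
    (hA : asymptotically_stable A)
    (hX_closed : closed (constraint_set c))
    (hX_bounded : bounded_set (constraint_set c))
    (hX_int : interior (constraint_set c) 0) :
  exists2 k : nat, (1 <= k)%N &
    set_sequence (degrees d c) A c k = set_sequence (degrees d c) A c k.+1 /\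
    maximal_admissible_invariant A (constraint_set c)
      (lower (degrees d c) (set_sequence (degrees d c) A c k)).
Proof.
have [r r0 rX] : exists2 r : R, 0 < r &
    forall x : 'cV[R]_n, `|x| < r -> constraint_set c x.
  by move: hX_int => /nbhs_norm0P[r r0 rX]; exists r.
have [T TP] := uniform_attraction A (constraint_set c) r hA hX_bounded r0.
have stat : set_sequence (degrees d c) A c T.+1 =
            set_sequence (degrees d c) A c T.+2.
  apply: set_sequence_stationary => // x Xx sigma t /ltnW Tt.
  exact/rX/TP.
by exists T.+1 => //; split => //; apply: maximal_of_stationary.
Qed.
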